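(* Let $p\ge 2$ be an integer and $q=1/p$. Then the measure of irrationality of $\zeta_q(2)$ satisfies $$r(\zeta_q(2))\le \frac{3\pi^2}{\pi^2-8}.$$
   Context: $\zeta_q(2)=\sum_{n=1}^\infty \frac{nq^n}{1-q^n}=\sum_{n=1}^\infty\frac{n}{p^n-1}$. For a real number $x$, the measure of irrationality is $$r(x)=\inf\{r\in\mathbb{R}: |x-a/b|<1/b^r \text{ has at most finitely many integer solutions } (a,b) \text{ with } b>0\}.$$ *)

(* Defs.v *)
From Stdlib Require Import Reals ZArith List.
From Coquelicot Require Import Coquelicot.

Open Scope R_scope.

(* [Series] sums from index 0, hence the shift [n = S k].  The series converges
   for |q| < 1, so no default value of [Series] is involved there. *)
Definition qzeta2 (q : R) : R :=
  Series (fun k => INR (S k) * q ^ S k / (1 - q ^ S k)).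

Definition approx_solution (x r : R) (a b : Z) : Prop :=
  (0 < b)%Z /\ Rabs (x - IZR a / IZR b) < 1 / Rpower (IZR b) r.

(* Pairs [(a, b)] are counted, not fractions: proportional pairs are distinct
   solutions. *)
Definition finitely_many_solutions (x r : R) : Prop :=
  exists l : list (Z * Z),
    forall a b : Z, approx_solution x r a b -> In (a, b) l.

(* The infimum is taken in [Rbar]: it is [p_infty] when no exponent [r] is
   admissible (rational or Liouville numbers). *)
Definition irrationality_measure (x : R) : Rbar :=
  Glb_Rbar (finitely_many_solutions x).

(* Main.v *)
(** Write P = p and let
      R(x) = x (x - P) ... (x - P^n) / ((x - 1) (P x - 1) ... (P^n x - 1))^2.
    The partial fraction expansion of R has poles of order at most two, and the
    residues at the simple ones sum to -R(0) = 0.  Hence the sum of R(P^k) over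
    k >= 1 equals A zeta_q(2) - C with rational A, C: the simple poles, which would
    contribute a multiple of zeta_q(1), only leave a finite sum.  As R vanishes at
    P, ..., P^n, this sum is positive and of size P^(-2 n^2 + O(n)).

    Expanding the two factors of R over simple poles by Lagrange interpolation
    gives coefficients that are Gaussian binomials times powers of P, up to the
    factor P^(n(n+1)/2) (P - 1) ... (P^n - 1).  For n = 2m, every P^k - 1 with
    1 <= k <= n divides D = (P^(m+1) - 1) ... (P^(2m) - 1), so multiplying further by
    D^2 makes A and C integers.  The resulting forms satisfy
      |A| <= P^(9 m^2 + O(m)),   A zeta_q(2) - C = P^(-m^2 + O(m)),
    which gives the irrationality exponent 1 + 9 = 10.  This crude denominator is
    good enough, since 10 < 3 pi^2 / (pi^2 - 8) as soon as pi < 3.38. *)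

Require Import Defs.
From Stdlib Require Import Reals ZArith List Lra Lia Psatz.
From Coquelicot Require Import Coquelicot.
From mathcomp Require all_boot all_order all_algebra Rstruct.
From mathcomp Require ring lra zify.

Open Scope R_scope.

(** * From linear forms to the irrationality exponent *)

Lemma nat_first_success (Q : nat -> Prop) (dec : forall n, {Q n} + {~ Q n}) n :
  ~ Q 0%nat -> Q n -> exists m, ~ Q m /\ Q (S m).
Proof.
  intros Q0; induction n as [|n IHn]; intros Qn; [contradiction|].
  destruct (dec n) as [h|h]; [now apply IHn|now exists n].
Qed.

Lemma finitely_many_solutions_of_bound (x r K : R) :
  (forall a b : Z, approx_solution x r a b -> Rabs (IZR a) <= K /\ Rabs (IZR b) <= K) ->
  finitely_many_solutions x r.
Proof.
  intros hK.
  set (N := Z.to_nat (up K)).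
  set (box := map (fun k => (Z.of_nat k - Z.of_nat N)%Z) (seq 0 (2 * N + 1))).
  assert (hbox : forall z : Z, Rabs (IZR z) <= K -> In z box).
  { intros z hz; apply in_map_iff.
    rewrite <- abs_IZR in hz.
    destruct (archimed K) as [hu _].
    assert (hz' : (Z.abs z < up K)%Z) by (apply lt_IZR; lra).
    exists (Z.to_nat (z + Z.of_nat N)); split; [|apply in_seq]; unfold N in *; lia. }
  exists (list_prod box box).
  intros a b h; destruct (hK a b h); apply in_prod; auto.
Qed.

(** The last two hypotheses give [2 b (A x - C) < 1]. As [b (A a / b - C)] is an integer, this
    forces [A x - C <= |A| |x - a / b|]. The final exponent adds up those bounding [|A|] and
    [1 / (A x - C)]. *)
Lemma distance_lower_bound (x P : R) (m : nat) (A C a b : Z) :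
  2 <= P -> (0 < b)%Z ->
  Rabs (IZR A) <= P ^ (9 * m * m + 12 * m) ->
  1 <= (IZR A * x - IZR C) * P ^ (m * m + 9 * m + 1) ->
  (IZR A * x - IZR C) * P ^ (m * m) <= P ^ (m + 2) ->
  2 * IZR b * P ^ (m + 2) < P ^ (m * m) ->
  1 <= Rabs (x - IZR a / IZR b) * P ^ (10 * m * m + 21 * m + 1).
Proof.
  intros hP hb hA hlow hup hbm.
  assert (hb' : 0 < IZR b) by now apply IZR_lt.
  assert (hpow : forall k, 0 < P ^ k) by (intros k; apply pow_lt; lra).
  set (eps := IZR A * x - IZR C) in *.
  assert (heps : 0 < eps).
  { specialize (hpow (m * m + 9 * m + 1)%nat).
    destruct (Rlt_le_dec 0 eps) as [h|h]; [exact h|nra]. }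
  assert (hsmall : 2 * IZR b * eps < 1).
  { specialize (hpow (m * m)%nat).
    apply Rmult_lt_reg_r with (P ^ (m * m)); [exact hpow|].
    apply Rle_lt_trans with (2 * IZR b * P ^ (m + 2)); nra. }
  assert (hdist : eps <= Rabs (IZR A) * Rabs (x - IZR a / IZR b)).
  { rewrite <- Rabs_mult.
    assert (e : IZR b * (IZR A * (x - IZR a / IZR b))
                = IZR b * eps - IZR (A * a - C * b)).
    { rewrite minus_IZR, !mult_IZR; unfold eps; field; lra. }
    (* [eps < 1 / (2 b)], so a nonzero [A a / b - C], being at least [1 / b], is at
       distance more than [eps] from [eps]; if it is zero the distance is [eps] itself. *)
    assert (hz : (A * a - C * b = 0 \/ A * a - C * b <= -1 \/ 1 <= A * a - C * b)%Z) by lia.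
    set (t := IZR A * (x - IZR a / IZR b)) in *.
    set (z := (A * a - C * b)%Z) in *.
    apply Rmult_le_reg_l with (IZR b); [exact hb'|].
    destruct hz as [hz|[hz|hz]].
    - rewrite hz in e. pose proof (Rle_abs t). nra.
    - apply IZR_le in hz. pose proof (Rle_abs t). nra.
    - apply IZR_le in hz. pose proof (Rle_abs (- t)). rewrite Rabs_Ropp in *. nra. }
  replace (10 * m * m + 21 * m + 1)%nat
    with ((9 * m * m + 12 * m) + (m * m + 9 * m + 1))%nat by ring.
  rewrite pow_add.
  pose proof (Rabs_pos (x - IZR a / IZR b)) as hd.
  pose proof (hpow (m * m + 9 * m + 1)%nat) as h1.
  apply Rle_trans with (1 := hlow).
  rewrite <- Rmult_assoc.
  apply Rmult_le_compat_r; [lra|].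
  apply Rle_trans with (1 := hdist).
  rewrite Rmult_comm; now apply Rmult_le_compat_l.
Qed.

Lemma pow_exp_ln (P : R) (k : nat) : 0 < P -> P ^ k = exp (INR k * ln P).
Proof. intros hP; rewrite <- Rpower_pow; [reflexivity|exact hP]. Qed.

Lemma exp_le_inv (s t : R) : exp s <= exp t -> s <= t.
Proof.
  intros h; destruct (Rle_lt_dec s t) as [|h']; [assumption|].
  apply exp_increasing in h'; lra.
Qed.

(** A solution with denominator [b] is tested against the form whose index [m] satisfies
    [m^2 ln P ~ ln b]. Consecutive forms have sizes close enough on this scale to give
    [r m^2 <= 10 m^2 + O(m)], which bounds [m], then [b], then [a]. *)
Lemma finitely_many_of_linear_forms (x P r : R) :
  2 <= P -> 10 < r ->
  (forall m : nat, exists A C : Z,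
    Rabs (IZR A) <= P ^ (9 * m * m + 12 * m) /\
    1 <= (IZR A * x - IZR C) * P ^ (m * m + 9 * m + 1) /\
    (IZR A * x - IZR C) * P ^ (m * m) <= P ^ (m + 2)) ->
  finitely_many_solutions x r.
Proof.
  intros hP hr hforms.
  assert (hL : 0 < ln P) by (rewrite <- ln_1; apply ln_increasing; lra).
  set (L := ln P) in *.
  (* With [M = INR m], the bounds [hmin] and [hdist] below give
     [(r - 10) M^2 < (r + 41) M + (3 r + 32)]. Hence [(r - 10) M < 4 r + 73], by division by [M] if
     [M >= 1] and trivially otherwise; adding [r - 10] bounds [(r - 10) (M + 1)] by [5 r + 63]. *)
  destruct (INR_unbounded ((5 * r + 63) / (r - 10))) as [N hN].
  apply finitely_many_solutions_of_bound with ((Rabs x + 1) * P ^ (N * N)).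
  intros a b [hb happ].
  assert (hb1 : 1 <= IZR b) by (apply IZR_le; lia).
  set (lb := ln (IZR b)).
  assert (hlb : IZR b = exp lb) by (unfold lb; rewrite exp_ln; lra).
  assert (hlb0 : 0 <= lb).
  { apply exp_le_inv; rewrite exp_0, <- hlb; exact hb1. }
  assert (happ' : Rabs (x - IZR a / IZR b) < exp (- (r * lb))).
  { rewrite exp_Ropp; unfold Rpower in happ; unfold lb; lra. }
  (* [Q m] makes form [m] usable against [b]. At an index where [Q] switches from false to true, the
     failure of [Q m] bounds [b] from below, while [Q (S m)] allows [distance_lower_bound] at
     [S m]. *)
  set (Q := fun m : nat => 2 * IZR b * P ^ (m + 2) < P ^ (m * m)).
  assert (hQ : exists n, Q n).
  { destruct (Pow_x_infinity P) with (b := 2 * IZR b + 1) as [n hn].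
    { rewrite Rabs_right; lra. }
    exists (n + 3)%nat; unfold Q.
    assert (h : P ^ n <= P ^ ((n + 3) * (n + 3) - (n + 5))).
    { apply Rle_pow; [lra|nia]. }
    assert (hPn : 2 * IZR b < P ^ n).
    { specialize (hn n (le_n n)). rewrite Rabs_right in hn; [lra|].
      apply Rle_ge, pow_le; lra. }
    replace ((n + 3) * (n + 3))%nat with (((n + 3) * (n + 3) - (n + 5)) + (n + 3 + 2))%nat by nia.
    rewrite (pow_add P ((n + 3) * (n + 3) - (n + 5))).
    apply Rmult_lt_compat_r; [apply pow_lt|]; lra. }
  destruct hQ as [n hQn].
  destruct (nat_first_success Q (fun m => Rlt_dec _ _) n) as [m [hm hSm]]; [|exact hQn|].
  { unfold Q; simpl; nra. }
  assert (hmin : (INR m ^ 2 - INR m - 3) * L <= lb).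
  { apply Rnot_lt_le in hm. rewrite !pow_exp_ln in hm by lra.
    assert (h2 : 2 <= exp L) by (unfold L; rewrite exp_ln; lra).
    rewrite hlb in hm. fold L in hm.
    assert (h : exp (INR (m * m) * L) <= exp (L + lb + INR (m + 2) * L)).
    { rewrite !exp_plus.
      apply Rle_trans with (1 := hm).
      apply Rmult_le_compat_r; [left; apply exp_pos|].
      apply Rmult_le_compat_r; [left; apply exp_pos|exact h2]. }
    apply exp_le_inv in h. rewrite mult_INR, plus_INR in h. simpl (INR 2) in h. nra. }
  assert (hdist : r * lb < (10 * INR (S m) ^ 2 + 21 * INR (S m) + 1) * L).
  { destruct (hforms (S m)) as [A [C [h1 [h2 h3]]]].
    pose proof (distance_lower_bound x P (S m) A C a b hP hb h1 h2 h3 hSm) as h.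
    rewrite pow_exp_ln in h by lra. fold L in h.
    destruct (Rlt_le_dec (r * lb) ((10 * INR (S m) ^ 2 + 21 * INR (S m) + 1) * L)) as [|h'];
      [assumption|exfalso].
    set (E := INR (10 * S m * S m + 21 * S m + 1) * L) in *.
    assert (hE : E <= r * lb).
    { unfold E. rewrite !plus_INR, !mult_INR. replace (INR 10) with 10 by (simpl; ring).
      replace (INR 21) with 21 by (simpl; ring). simpl (INR 1). lra. }
    assert (h4 : exp (- (r * lb)) * exp E <= 1).
    { rewrite <- exp_plus, <- exp_0. destruct (Rle_lt_or_eq_dec _ _ hE) as [h5|h5].
      - left; apply exp_increasing; lra.
      - right; f_equal; lra. }
    pose proof (exp_pos E). nra. }
  assert (hSmN : INR (S m) < INR N).
  { apply Rle_lt_trans with (2 := hN).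
    apply Rmult_le_reg_r with (r - 10); [lra|].
    unfold Rdiv; rewrite Rmult_assoc, Rinv_l, Rmult_1_r by lra.
    rewrite S_INR in *. pose proof (pos_INR m).
    assert (h : r * (INR m ^ 2 - INR m - 3) < 10 * (INR m + 1) ^ 2 + 21 * (INR m + 1) + 1).
    { apply Rmult_lt_reg_r with L; [exact hL|]. nra. }
    nra. }
  assert (hbN : IZR b <= P ^ (N * N)).
  { apply Rle_trans with (P ^ (S m * S m)).
    - unfold Q in hSm. assert (1 <= P ^ (S m + 2)) by (apply pow_R1_Rle; lra). nra.
    - apply Rle_pow; [lra|]. apply INR_lt in hSmN. nia. }
  assert (hd1 : Rabs (x - IZR a / IZR b) <= 1).
  { apply Rlt_le, Rlt_le_trans with (1 := happ').
    rewrite <- exp_0. destruct (Rle_lt_or_eq_dec 0 (r * lb)) as [h|h]; [nra| |].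
    - left; apply exp_increasing; lra.
    - right; f_equal; lra. }
  assert (hx0 := Rabs_pos x).
  assert (hPN : 0 < P ^ (N * N)) by lra.
  split; [|rewrite Rabs_right; nra].
  apply Rle_trans with ((Rabs x + 1) * IZR b); [|nra].
  replace (IZR a) with ((x - (x - IZR a / IZR b)) * IZR b) by (field; lra).
  rewrite Rabs_mult, (Rabs_right (IZR b)) by lra.
  apply Rmult_le_compat_r; [lra|].
  apply Rle_trans with (1 := Rabs_triang _ _). rewrite Rabs_Ropp. lra.
Qed.

Module LinearForms.
Import all_boot all_order all_algebra Rstruct.
Import mathcomp.algebra_tactics.ring mathcomp.algebra_tactics.lra mathcomp.zify.zify.
Set Implicit Arguments.
Unset Strict Implicit.
Unset Printing Implicit Defensive.
Import Order.TTheory GRing.Theory Num.Theory.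
Local Open Scope ring_scope.

(** * Partial fractions *)

Section PartialFractions.
Variable F : fieldType.

Lemma size_prod_affine (I : Type) (r : seq I) (Q : pred I) (w : I -> F) :
  (size (\prod_(i <- r | Q i) (w i *: 'X - 1) : {poly F})%R
     <= (count Q r).+1)%N.
Proof.
elim: r => [|i r IHr] /=; first by rewrite big_nil size_poly1.
rewrite big_cons; case: (Q i) => //=.
apply: leq_trans (size_polyMleq _ _) _.
have : (size (w i *: 'X - 1 : {poly F})%R <= 2)%N.
  apply: leq_trans (size_polyD _ _) _.
  rewrite size_polyN size_poly1 geq_max andbT.
  by apply: leq_trans (size_scale_leq _ _) _; rewrite size_polyX.
move: IHr; move: (size _) (size _) (count _ _) => a b c; lia.
Qed.

(** Lagrange interpolation at the [n + 1] nodes [(w j)^-1]: the difference [g] between [f] and its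
    interpolant has size at most [n + 1] and [n + 1] distinct roots, so it is zero. *)
Lemma partial_fractions (n : nat) (w : 'I_n.+1 -> F) (f : {poly F}) (x : F) :
  (forall i, w i != 0) -> injective w -> (size f <= n.+1)%N ->
  (forall i, w i * x - 1 != 0) ->
  f.[x] / \prod_i (w i * x - 1) =
  \sum_j f.[(w j)^-1] / \prod_(i | i != j) (w i / w j - 1) / (w j * x - 1).
Proof.
move=> w0 winj szf wx.
pose c j := f.[(w j)^-1] / \prod_(i | i != j) (w i / w j - 1).
pose g := f - \sum_j c j *: \prod_(i | i != j) (w i *: 'X - 1).
have hornerP y (j : 'I_n.+1) :
  (\prod_(i | i != j) (w i *: 'X - 1)).[y] = \prod_(i | i != j) (w i * y - 1).
  by rewrite horner_prod; apply: eq_bigr => i _; rewrite !hornerE.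
have g0 : g = 0.
  apply/eqP/negPn/negP => gN0.
  have := max_poly_roots gN0 (rs := [seq (w j)^-1 | j <- enum 'I_n.+1]).
  rewrite size_map size_enum_ord => hroots.
  suff : (n.+1 < size g)%N.
    apply/negP; rewrite -leqNgt.
    apply: leq_trans (size_polyD _ _) _; rewrite geq_max szf size_polyN /=.
    apply: leq_trans (size_sum _ _ _) _; apply/bigmax_leqP => j _.
    apply: leq_trans (size_scale_leq _ _) _.
    apply: leq_trans (size_prod_affine _ _ _) _.
    by rewrite -sum1_count (sum1_card (predC1 j)) cardC1 card_ord.
  apply: hroots.
    apply/allP => _ /mapP[k _ ->]; apply/rootP.
    rewrite hornerD hornerN horner_sum.
    under eq_bigr => j _ do rewrite hornerZ hornerP.
    rewrite (bigD1 k)//= [X in _ - (_ + X)]big1 ?addr0 => [|j jk].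
      rewrite /c divfK ?subrr//.
      apply/prodf_neq0 => i ik; rewrite subr_eq0; apply: contraNneq ik.
      by move=> /divr1_eq/winj ->.
    by rewrite (bigD1 k) 1?eq_sym//= divff ?subrr ?mul0r ?mulr0.
  rewrite map_inj_uniq ?enum_uniq// => i j /invr_inj; exact: winj.
have -> : f.[x] = \sum_j c j * \prod_(i | i != j) (w i * x - 1).
  have /eqP := g0; rewrite subr_eq0 => /eqP ->; rewrite horner_sum.
  by apply: eq_bigr => j _; rewrite hornerZ hornerP.
rewrite mulr_suml; apply: eq_bigr => j _; rewrite -/(c j) -mulrA; congr (_ * _).
rewrite [\prod_i (_ - 1)](bigD1 j)//= invfM mulrCA divff ?mulr1//.
by apply/prodf_neq0 => i _; exact: wx.
Qed.

End PartialFractions.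

(** * The rational function and its coefficients *)

(** The number [n (n + 1) / 2], kept as a sum so that [prodrXr] produces it directly from a product
    of powers. *)
Definition triangle (n : nat) : nat := \sum_(k < n) k.+1.

Lemma triangle_mul2 n : (triangle n * 2 = n * n.+1)%N.
Proof.
elim: n => [|n IHn]; first by rewrite /triangle big_ord0.
by move: IHn; rewrite /triangle big_ord_recr /=; lia.
Qed.

Section Construction.
Variables (F : archiRealFieldType) (P : F).
Hypotheses (P_int : P \is a Num.int) (P_ge2 : 2 <= P).

(** The [P]-factorial without its usual denominator [(P - 1)^n], which would cancel in Gaussian
    binomials. *)
Definition qfact (n : nat) : F := \prod_(k < n) (P ^+ k.+1 - 1).

Let P_gt0 : 0 < P. Proof. by move: P_ge2; lra. Qed.
Let P_gt1 : 1 < P. Proof. by move: P_ge2; lra. Qed.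
Let PX_gt0 n : 0 < P ^+ n. Proof. exact: exprn_gt0. Qed.
Let PX_neq0 n : P ^+ n != 0. Proof. exact: lt0r_neq0. Qed.
Let PX_ge0 n : 0 <= P ^+ n. Proof. exact: ltW. Qed.
Let PX_ge1 n : 1 <= P ^+ n. Proof. by apply: exprn_ege1; apply: ltW. Qed.
Let PX_le m n : (m <= n)%N -> P ^+ m <= P ^+ n.
Proof. by move=> mn; rewrite ler_eXn2l. Qed.

Lemma powS_sub1_ge n : P ^+ n <= P ^+ n.+1 - 1.
Proof.
have : 1 <= P ^+ n by apply: exprn_ege1; apply: ltW.
have := ler_wpM2r (ltW (PX_gt0 n)) P_ge2; rewrite exprS; lra.
Qed.

Lemma powS_sub1_gt0 n : 0 < P ^+ n.+1 - 1.
Proof. exact: lt_le_trans (powS_sub1_ge n). Qed.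

Let pow_sub1_neq0 n : P ^+ n.+1 - 1 != 0.
Proof. by rewrite gt_eqF// powS_sub1_gt0. Qed.

Lemma qfact_gt0 n : 0 < qfact n.
Proof. by apply: prodr_gt0 => i _; exact: powS_sub1_gt0. Qed.

Let qfact_neq0 n : qfact n != 0. Proof. by rewrite gt_eqF// qfact_gt0. Qed.

Lemma qfactS n : qfact n.+1 = qfact n * (P ^+ n.+1 - 1).
Proof. by rewrite /qfact big_ord_recr. Qed.

Lemma qfact0 : qfact 0 = 1. Proof. by rewrite /qfact big_ord0. Qed.

Lemma qfactD j n : qfact (j + n) = qfact j * \prod_(i < n) (P ^+ (j + i).+1 - 1).
Proof. by rewrite /qfact big_split_ord. Qed.

(** Induction by the [P]-analogue of Pascal's rule. The induction runs on a bound for [j + k], since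
    the two terms lower different indices. *)
Lemma qbinomial_int j k : qfact (j + k) / (qfact j * qfact k) \is a Num.int.
Proof.
move: {2}(j + k)%N (leqnn (j + k)) => N; elim: N j k => [|N IHN] [|j] [|k] hN;
  rewrite ?addn0 ?add0n ?qfact0 ?mul1r ?mulr1 ?divff ?invr1 ?rpred1 ?qfact_neq0//.
have -> : qfact (j.+1 + k.+1) / (qfact j.+1 * qfact k.+1)
   = qfact (j + k.+1) / (qfact j * qfact k.+1) * P ^+ k.+1
     + qfact (j.+1 + k) / (qfact j.+1 * qfact k).
  rewrite !addSn !addnS (qfactS (j + k).+1) (qfactS j) (qfactS k).
  have -> : P ^+ (j + k).+2 = P ^+ j.+1 * P ^+ k.+1 by rewrite -exprD addSn addnS.
  by field; rewrite !pow_sub1_neq0 !qfact_neq0.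
by apply: rpredD; [apply: rpredM; [|exact: rpredX]|]; apply: IHN; lia.
Qed.

Definition qbinomial n j := qfact n / (qfact j * qfact (n - j)).

Lemma qbinomial_is_int n j : (j <= n)%N -> qbinomial n j \is a Num.int.
Proof. by move=> jn; rewrite /qbinomial -{1}(subnKC jn); exact: qbinomial_int. Qed.

(** The factors with [i > l] form [qfact (n - l)]. Those with [i < l] equal
    [-(P^(l-i) - 1) / P^(l-i)], which accounts for the sign, [qfact l] and the power of [P]. *)
Lemma prod_nodes n l : (l <= n)%N ->
  \prod_(i < n.+1 | i != l :> nat) (P ^+ i / P ^+ l - 1)
  = (-1) ^+ l * qfact l * qfact (n - l) / P ^+ triangle l.
Proof.
move=> ln; rewrite -(big_mkord (fun i => i != l) (fun i => P ^+ i / P ^+ l - 1)).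
rewrite (@big_cat_nat _ _ _ l)//=; last by lia.
rewrite [X in _ * X]big_ltn_cond ?ltnS// eqxx /=.
have -> : \prod_(l.+1 <= i < n.+1 | i != l) (P ^+ i / P ^+ l - 1) = qfact (n - l).
  rewrite -{1}(add0n l.+1) big_addn subSS big_mkord /qfact.
  apply: eq_big => [i|i _]; first by case: eqP => //; have := ltn_ord i; lia.
  by rewrite addnS -addSn exprD mulfK.
have -> : \prod_(0 <= i < l | i != l) (P ^+ i / P ^+ l - 1)
   = (-1) ^+ l * qfact l / P ^+ triangle l; last by field.
rewrite big_nat_rev /= add0n /qfact /triangle -prodrXr.
rewrite -[in (-1) ^+ l](card_ord l) -prodr_const -prodfV -!big_split /= big_mkord.
apply: eq_big => [i|i _]; first by case: eqP => //; have := ltn_ord i; lia.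
have -> : P ^+ l = P ^+ (l - i.+1) * P ^+ i.+1 by rewrite -exprD subnK.
by field; rewrite !PX_neq0.
Qed.

Definition recip_coef n l := (-1) ^+ l * P ^+ triangle l * qbinomial n l.
Definition numer_coef n j :=
  (-1) ^+ (n + j) * P ^+ triangle (n - j) * qbinomial (n + j) n * qbinomial n j.

Definition polefun j x : F := (P ^+ j * x - 1)^-1.
Definition nonpole n x := forall i : 'I_n.+1, P ^+ i * x - 1 != 0.

Let node_neq0 n (i : 'I_n.+1) : P ^+ i != 0. Proof. exact: PX_neq0. Qed.
Let node_inj n : injective (fun i : 'I_n.+1 => P ^+ i).
Proof. by move=> i j /(ieexprIn P_gt0 (negbT (gt_eqF P_gt1))) /val_inj. Qed.

Lemma recip_partial_fractions n x : nonpole n x ->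
  qfact n / \prod_(i < n.+1) (P ^+ i * x - 1)
  = \sum_(l < n.+1) recip_coef n l * polefun l x.
Proof.
move=> hx; have := partial_fractions (@node_neq0 n) (@node_inj n) _ hx.
move=> /(_ 1); rewrite hornerE mul1r size_poly1 => ->//.
rewrite mulr_sumr; apply: eq_bigr => l _; rewrite -polyC1 hornerC mulrA; congr (_ / _).
have ln : (l <= n)%N by rewrite -ltnS.
rewrite (prod_nodes ln) /recip_coef /qbinomial.
rewrite !invfM invr_sign invrK.
by field; rewrite !qfact_neq0.
Qed.

Lemma numerator_at_node n j :
  (\prod_(i < n) ('X - (P ^+ i.+1)%:P)).[(P ^+ j)^-1]
  = (-1) ^+ n * qfact (n + j) / (qfact j * P ^+ (j * n)).
Proof.
rewrite horner_prod addnC qfactD.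
have -> : (-1) ^+ n * (qfact j * \prod_(i < n) (P ^+ (j + i).+1 - 1))
     / (qfact j * P ^+ (j * n))
   = (- (P ^+ j)^-1) ^+ n * \prod_(i < n) (P ^+ (j + i).+1 - 1).
  rewrite exprM [in RHS]exprNn exprVn.
  by field; rewrite qfact_neq0 expf_neq0.
have -> : (- (P ^+ j)^-1) ^+ n = \prod_(i < n) - (P ^+ j)^-1.
  by rewrite prodr_const card_ord.
rewrite -big_split /=; apply: eq_bigr => i _.
rewrite hornerD hornerN hornerX hornerC -addnS exprD.
by field; rewrite PX_neq0.
Qed.

(** The product without the factor [x] has size [n + 1], so interpolation applies to it; the extra
    [x] is then absorbed through [x * polefun j x = (1 + polefun j x) / P^j]. *)
Lemma numerator_partial_fractions n x : nonpole n x ->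
  P ^+ triangle n * (x * \prod_(i < n) (x - P ^+ i.+1))
    / \prod_(i < n.+1) (P ^+ i * x - 1)
  = \sum_(j < n.+1) numer_coef n j * (1 + polefun j x).
Proof.
move=> hx.
pose f := \prod_(i < n) ('X - (P ^+ i.+1)%:P).
have szf : (size f <= n.+1)%N by rewrite /f -big_enum size_prod_XsubC size_enum_ord.
have := partial_fractions (@node_neq0 n) (@node_inj n) szf hx.
have -> : f.[x] = \prod_(i < n) (x - P ^+ i.+1).
  by rewrite horner_prod; apply: eq_bigr => i _; rewrite !hornerE.
rewrite mulrA -mulrA => ->; rewrite mulr_sumr; apply: eq_bigr => j _.
have jn : (j <= n)%N by rewrite -ltnS.
rewrite numerator_at_node (prod_nodes jn) /numer_coef /qbinomial addKn.
(* This is [triangle (n - j) = triangle n + triangle j - j n - j]. It shows that the prefactor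
   [P ^+ triangle n] clears all powers of [P] from the denominators. *)
have -> : P ^+ triangle (n - j) = P ^+ triangle n * P ^+ triangle j / (P ^+ (j * n) * P ^+ j).
  apply: (canRL (mulfK _)); first by rewrite mulf_neq0.
  rewrite -!exprD; congr (_ ^+ _).
  have := triangle_mul2 n; have := triangle_mul2 j; have := triangle_mul2 (n - j).
  nia.
rewrite /polefun !invfM invr_sign invrK exprD.
by field; rewrite !qfact_neq0 !PX_neq0 (hx j).
Qed.

Let sign_int n : ((-1) ^+ n : F) \is a Num.int. Proof. by rewrite rpredX ?rpredN1. Qed.

Lemma recip_coef_int n l : (l <= n)%N -> recip_coef n l \is a Num.int.
Proof.
move=> ln; apply: rpredM; last exact: qbinomial_is_int.
by apply: rpredM; [exact: sign_int|exact: rpredX].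
Qed.

Lemma numer_coef_int n j : (j <= n)%N -> numer_coef n j \is a Num.int.
Proof.
move=> jn; apply: rpredM; last exact: qbinomial_is_int.
apply: rpredM; last by apply: qbinomial_is_int; exact: leq_addr.
by apply: rpredM; [exact: sign_int|exact: rpredX].
Qed.

(** * Common denominators of the coefficients *)

Definition upper_prod m : F := \prod_(i < m) (P ^+ (m + i).+1 - 1).

Lemma upper_prod_gt0 m : 0 < upper_prod m.
Proof. by apply: prodr_gt0 => i _; exact: powS_sub1_gt0. Qed.

Lemma upper_prod_int m : upper_prod m \is a Num.int.
Proof. by apply: rpred_prod => i _; apply: rpredB; [exact: rpredX|exact: rpred1]. Qed.

(* Doubling [k] repeatedly lands it in (m, 2m], and [P ^ k - 1] divides
   [P ^ (2 k) - 1]. *)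
Lemma upper_prod_divisible m k : (0 < k <= m.*2)%N ->
  upper_prod m / (P ^+ k - 1) \is a Num.int.
Proof.
move: {2}(m.*2 - k)%N (leqnn (m.*2 - k)%N) => N.
elim: N k => [|N IHN] k hN /andP[k0 km].
all: have [mk|mk] := ltnP m k; last try by exfalso; lia.
1,2: have hk : (k - m.+1 < m)%N by lia.
1,2: have -> : k = (m + Ordinal hk).+1 by rewrite /=; lia.
1,2: rewrite /upper_prod (bigD1 (Ordinal hk))//= mulrAC divff ?mul1r//.
1,2: by apply: rpred_prod => i _; apply: rpredB; [exact: rpredX|exact: rpred1].
have -> : upper_prod m / (P ^+ k - 1) = upper_prod m / (P ^+ k.*2 - 1) * (P ^+ k + 1).
  have := pow_sub1_neq0 k.-1; have := pow_sub1_neq0 k.*2.-1.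
  rewrite !prednK ?double_gt0// -addnn exprD => h2 h1.
  by field; rewrite h1 h2.
apply: rpredM; first by apply: IHN; lia.
by apply: rpredD; [exact: rpredX|exact: rpred1].
Qed.

(* The coefficient of [polefun j] in [upper_prod m * polefun j * polefun l];
   for [j = l] the division by zero makes it 0. *)
Definition cross_coef m j l : F := - (upper_prod m * P ^+ j / (P ^+ j - P ^+ l)).

(** The numerator [P^j] cancels the smaller power of [P] taken out of [P^j - P^l]. Up to sign and a
    power of [P], what remains is [upper_prod m / (P^|j-l| - 1)]. *)
Lemma cross_coef_int m j l : (j <= m.*2)%N -> (l <= m.*2)%N -> cross_coef m j l \is a Num.int.
Proof.
move=> jm lm; rewrite /cross_coef; have [jl|lj|->] := ltngtP j l; last first.
- by rewrite subrr invr0 mulr0 oppr0 rpred0.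
- have h : P ^+ (j - l) - 1 != 0 by rewrite -(@prednK (j - l)) ?subn_gt0.
  have -> : - (upper_prod m * P ^+ j / (P ^+ j - P ^+ l))
      = - (upper_prod m / (P ^+ (j - l) - 1)) * P ^+ (j - l).
    have -> : P ^+ j = P ^+ l * P ^+ (j - l) by rewrite -exprD subnKC// ltnW.
    by field; rewrite h -[X in _ - X]mulr1 -mulrBr mulf_neq0.
  apply: rpredM; last exact: rpredX.
  by rewrite rpredN; apply: upper_prod_divisible; lia.
- have h : P ^+ (l - j) - 1 != 0 by rewrite -(@prednK (l - j)) ?subn_gt0.
  have -> : - (upper_prod m * P ^+ j / (P ^+ j - P ^+ l))
      = upper_prod m / (P ^+ (l - j) - 1).
    have -> : P ^+ l = P ^+ j * P ^+ (l - j) by rewrite -exprD subnKC// ltnW.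
    field; rewrite h -[X in X - _]mulr1 -mulrBr mulf_neq0//.
    by rewrite -opprB oppr_eq0.
  by apply: upper_prod_divisible; lia.
Qed.

Lemma polefun_mul m n x (j l : 'I_n.+1) : nonpole n x ->
  upper_prod m * (polefun j x * polefun l x)
  = cross_coef m j l * polefun j x + cross_coef m l j * polefun l x
    + (if l == j then upper_prod m * polefun j x ^+ 2 else 0).
Proof.
move=> hx; rewrite /cross_coef; case: eqVneq => [->|lj].
  by rewrite subrr invr0 mulr0 oppr0 !mul0r !add0r expr2.
have h : P ^+ l - P ^+ j != 0 by rewrite subr_eq0; apply: contraNneq lj => /node_inj ->.
rewrite /polefun; field.
by rewrite (hx j) (hx l) h -opprB oppr_eq0 h.
Qed.

(* Up to [P ^ triangle n] and [qfact n], this is the product of the two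
   simple-pole expansions above. *)
Definition integrand n x : F :=
  x * \prod_(i < n) (x - P ^+ i.+1) / (\prod_(i < n.+1) (P ^+ i * x - 1)) ^+ 2.

(** * Expansion over simple and double poles *)

Definition double_coef n j := numer_coef n j * recip_coef n j.
(** The double poles are grouped as [polefun + polefun^2], which becomes a summand of zeta_q(2) at
    powers of [P]; the subtracted last term compensates for this. The middle term comes from the
    constants 1 in [numerator_partial_fractions]. *)
Definition simple_coef m j := let n := m.*2 in
  \sum_(l < n.+1) (numer_coef n j * recip_coef n l + numer_coef n l * recip_coef n j) * cross_coef m j l
  + upper_prod m * (\sum_(l < n.+1) numer_coef n l) * recip_coef n j
  - upper_prod m * double_coef n j.

Lemma double_coef_int n j : (j <= n)%N -> double_coef n j \is a Num.int.
Proof. by move=> jn; apply: rpredM; [exact: numer_coef_int|exact: recip_coef_int]. Qed.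

Lemma simple_coef_int m j : (j <= m.*2)%N -> simple_coef m j \is a Num.int.
Proof.
move=> jm; apply: rpredB.
  apply: rpredD.
    apply: rpred_sum => l _; have lm : (l <= m.*2)%N by rewrite -ltnS.
    apply: rpredM; last exact: cross_coef_int.
    by apply: rpredD; apply: rpredM; (exact: numer_coef_int || exact: recip_coef_int).
  apply: rpredM; last exact: recip_coef_int.
  apply: rpredM; first exact: upper_prod_int.
  by apply: rpred_sum => l _; apply: numer_coef_int; rewrite -ltnS.
by apply: rpredM; [exact: upper_prod_int|exact: double_coef_int].
Qed.

Definition normalizer m : F :=
  upper_prod m * P ^+ triangle m.*2 * qfact m.*2.

Lemma integrand_partial_fractions m x : nonpole m.*2 x ->
  normalizer m * integrand m.*2 x
  = upper_prod m * \sum_(j < m.*2.+1) double_coef m.*2 j * (polefun j x + polefun j x ^+ 2)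
    + \sum_(j < m.*2.+1) simple_coef m j * polefun j x.
Proof.
move=> hx; set n := m.*2 in hx *.
have -> : normalizer m * integrand n x
   = upper_prod m * ((\sum_(j < n.+1) numer_coef n j * (1 + polefun j x))
                     * (\sum_(l < n.+1) recip_coef n l * polefun l x)).
  rewrite -recip_partial_fractions// -numerator_partial_fractions//.
  rewrite /normalizer /integrand -/n; field.
  by apply/prodf_neq0 => i _; exact: hx.
have -> : upper_prod m * ((\sum_(j < n.+1) numer_coef n j * (1 + polefun j x))
                     * (\sum_(l < n.+1) recip_coef n l * polefun l x))
  = \sum_(j < n.+1) \sum_(l < n.+1) (numer_coef n j * recip_coef n l * cross_coef m j l) * polefun j x
  + \sum_(j < n.+1) \sum_(l < n.+1) (numer_coef n j * recip_coef n l * cross_coef m l j) * polefun l x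
  + \sum_(j < n.+1) \sum_(l < n.+1) (upper_prod m * numer_coef n j * recip_coef n l) * polefun l x
  + \sum_(j < n.+1) \sum_(l < n.+1)
      (if l == j then upper_prod m * double_coef n j * polefun j x ^+ 2 else 0).
  rewrite mulr_suml mulr_sumr -!big_split /=; apply: eq_bigr => j _.
  rewrite !mulr_sumr -!big_split /=; apply: eq_bigr => l _.
  have := polefun_mul m j l hx; case: eqVneq => [->|_] /= e; rewrite /double_coef/=.
    by rewrite /cross_coef subrr invr0; ring.
  have -> : upper_prod m * (numer_coef n j * (1 + polefun j x) * (recip_coef n l * polefun l x))
      = numer_coef n j * recip_coef n l * (upper_prod m * polefun l x + upper_prod m * (polefun j x * polefun l x)).
    by ring.
  by rewrite e; ring.
(* Swapping the order in the second and third sums makes the outer index the one carried by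
   [polefun] everywhere, so that coefficients can be compared pole by pole. *)
rewrite [X in _ + X + _ + _]exchange_big [X in _ + X + _ = _]exchange_big /=.
rewrite mulr_sumr -!big_split /=; apply: eq_bigr => j _.
rewrite -big_mkcond big_pred1_eq -!mulr_suml -!mulr_sumr /simple_coef -/n.
under [X in _ = _ + (X + _ - _) * _]eq_bigr => l _ do rewrite mulrDl.
rewrite big_split /=; ring.
Qed.

(** Evaluation at [x = 0]: the integrand vanishes there, and every [polefun j 0 = -1] makes
    [polefun + polefun^2] vanish, so only minus the sum of the simple coefficients is left. *)
Lemma sum_simple_coef m : \sum_(j < m.*2.+1) simple_coef m j = 0.
Proof.
have h0 : nonpole m.*2 0 by move=> i; rewrite mulr0 sub0r oppr_eq0 oner_neq0.
have := integrand_partial_fractions h0.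
rewrite /integrand mul0r mul0r mulr0.
have p0 j : polefun j 0 = -1 by rewrite /polefun mulr0 sub0r invrN invr1.
under eq_bigr => j _ do rewrite p0 sqrrN expr1n addNr mulr0.
rewrite big1 // mulr0 add0r.
under eq_bigr => j _ do rewrite p0 mulrN1.
by rewrite sumrN => /eqP; rewrite eq_sym oppr_eq0 => /eqP.
Qed.

(** * Summation over the powers of [P] *)

Definition zterm k : F := (P ^+ k - 1)^-1.
Definition zsum1 K : F := \sum_(k < K) zterm k.+1.
(** Since [zterm k + zterm k ^+ 2 = q^k / (1 - q^k)^2] with [q = 1 / P], these are partial sums of
    zeta_q(2) in its second Lambert form, while [zsum1] belongs to zeta_q(1). *)
Definition zsum2 K : F := \sum_(k < K) (zterm k.+1 + zterm k.+1 ^+ 2).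

Lemma nonpole_pow n k : nonpole n (P ^+ k.+1).
Proof. by move=> i; rewrite -exprD addnS gt_eqF// powS_sub1_gt0. Qed.

Lemma polefun_pow j k : polefun j (P ^+ k) = zterm (j + k).
Proof. by rewrite /polefun /zterm exprD. Qed.

(** [lead] and [offset] are the integers A and C. The factor [upper_prod m] added to [normalizer m]
    clears the denominators [(P^k - 1)^2] in [zsum2]. *)
Definition weight m : F := upper_prod m * normalizer m.
Definition lead m : F := upper_prod m ^+ 2 * \sum_(j < m.*2.+1) double_coef m.*2 j.
Definition offset m : F := \sum_(j < m.*2.+1)
  (upper_prod m ^+ 2 * double_coef m.*2 j * zsum2 j + upper_prod m * simple_coef m j * zsum1 j).

(** At [P^(k+1)] the pole function of index [j] is [zterm (j + k + 1)], so summing over [k] gives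
    tails of [zsum1] and [zsum2] starting after [j]. The missing initial segments make up
    [offset]. *)
Lemma sum_integrand m K :
  weight m * \sum_(k < K) integrand m.*2 (P ^+ k.+1)
  = \sum_(j < m.*2.+1)
      (upper_prod m ^+ 2 * double_coef m.*2 j * zsum2 (j + K)
        + upper_prod m * simple_coef m j * zsum1 (j + K)) - offset m.
Proof.
rewrite /weight -mulrA mulr_sumr.
have pf k : normalizer m * integrand m.*2 (P ^+ k.+1)
   = upper_prod m * (\sum_(j < m.*2.+1)
       double_coef m.*2 j * (zterm (j + k.+1) + zterm (j + k.+1) ^+ 2))
     + \sum_(j < m.*2.+1) simple_coef m j * zterm (j + k.+1).
  rewrite (integrand_partial_fractions (@nonpole_pow _ k)).
  by congr (_ * _ + _); apply: eq_bigr => j _; rewrite polefun_pow.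
under eq_bigr => k _ do rewrite pf.
rewrite /offset -sumrB big_split /= -!mulr_sumr mulrDr.
rewrite [\sum_(k < K) \sum_(j < _) (double_coef _ _ * _)]exchange_big /=.
rewrite [\sum_(k < K) \sum_(j < _) _]exchange_big /=.
rewrite mulrA !mulr_sumr -big_split /=; apply: eq_bigr => j _.
have e1 : zsum1 (j + K) = zsum1 j + \sum_(k < K) zterm (j + k.+1).
  rewrite /zsum1 big_split_ord /=; congr (_ + _).
  by apply: eq_bigr => k _; rewrite addnS.
have e2 : zsum2 (j + K) = zsum2 j + \sum_(k < K) (zterm (j + k.+1) + zterm (j + k.+1) ^+ 2).
  rewrite /zsum2 big_split_ord /=; congr (_ + _).
  by apply: eq_bigr => k _; rewrite addnS.
by rewrite e1 e2 -!mulr_sumr; ring.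
Qed.

Lemma lead_int m : lead m \is a Num.int.
Proof.
apply: rpredM; first by apply: rpredX; exact: upper_prod_int.
by apply: rpred_sum => j _; apply: double_coef_int => //; rewrite -ltnS.
Qed.

Lemma offset_int m : offset m \is a Num.int.
Proof.
apply: rpred_sum => j _; have jm : (j <= m.*2)%N by rewrite -ltnS.
have ht (k : 'I_j) : upper_prod m * zterm k.+1 \is a Num.int.
  by apply: upper_prod_divisible => //; rewrite (leq_trans _ jm).
apply: rpredD.
  rewrite mulrAC; apply: rpredM; last exact: double_coef_int.
  rewrite mulr_sumr; apply: rpred_sum => k _.
  have -> : upper_prod m ^+ 2 * (zterm k.+1 + zterm k.+1 ^+ 2)
    = upper_prod m * (upper_prod m * zterm k.+1) + (upper_prod m * zterm k.+1) ^+ 2.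
    by ring.
  by apply: rpredD; [apply: rpredM => //; exact: upper_prod_int|exact: rpredX].
rewrite mulrAC; apply: rpredM; last exact: simple_coef_int.
by rewrite mulr_sumr; apply: rpred_sum.
Qed.

(** * Size of the weight and of the leading coefficient *)

Lemma prod_pow_sub1_bounds N (e : nat -> nat) :
  P ^+ (\sum_(i < N) e i) <= \prod_(i < N) (P ^+ (e i).+1 - 1)
    <= P ^+ (\sum_(i < N) (e i).+1).
Proof.
rewrite -!prodrXr; apply/andP; split; apply: ler_prod => i _.
  by rewrite PX_ge0 powS_sub1_ge.
by rewrite (ltW (powS_sub1_gt0 _)) lerBlDr lerDl ler01.
Qed.

Lemma sum_ord_mul2 N a : ((\sum_(i < N) (a + i)) * 2 + N = N * N + 2 * a * N)%N.
Proof.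
elim: N => [|N IHN]; first by rewrite big_ord0; lia.
rewrite big_ord_recr /=; move: (\sum_(i < N) _) IHN => s; lia.
Qed.

Lemma triangleE n : triangle n = (\sum_(i < n) i + n)%N.
Proof. by rewrite /triangle; under eq_bigr do rewrite -addn1; rewrite big_split /= sum1_card card_ord. Qed.

Lemma qfact_bounds n : P ^+ triangle n <= qfact n * P ^+ n /\ qfact n <= P ^+ triangle n.
Proof.
have /andP[lo hi] := prod_pow_sub1_bounds n id; split; last exact: hi.
by rewrite triangleE exprD ler_wpM2r.
Qed.

Lemma upper_prod_bounds m : P ^+ (3 * m * m) <= upper_prod m ^+ 2 * P ^+ m
  /\ upper_prod m ^+ 2 <= P ^+ (3 * m * m + m).
Proof.
have /andP[lo hi] := prod_pow_sub1_bounds m (addn m); split.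
  have -> : (3 * m * m = (\sum_(i < m) (m + i)) * 2 + m)%N by rewrite sum_ord_mul2; lia.
  by rewrite exprD exprM ler_wpM2r// lerXn2r// nnegrE ?PX_ge0// ltW// upper_prod_gt0.
have -> : (3 * m * m + m = (\sum_(i < m) (m + i).+1) * 2)%N.
  have := sum_ord_mul2 m m.+1; under eq_bigr => i _ do rewrite addSn.
  move: (\sum_(i < m) _) => s; lia.
by rewrite exprM lerXn2r// nnegrE ?PX_ge0// ltW// upper_prod_gt0.
Qed.

Lemma weight_gt0 m : 0 < weight m.
Proof. by rewrite /weight /normalizer !mulr_gt0// ?upper_prod_gt0// qfact_gt0. Qed.

(** The 7 is 3 from [upper_prod m ^+ 2], plus 2 each from [P ^+ triangle m.*2] and [qfact m.*2]. *)
Lemma weight_bounds m :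
  P ^+ (7 * m * m) <= weight m * P ^+ m /\ weight m <= P ^+ (7 * m * m + 3 * m).
Proof.
have -> : weight m = upper_prod m ^+ 2 * P ^+ triangle m.*2 * qfact m.*2.
  by rewrite /weight /normalizer; ring.
have [lo hi] := upper_prod_bounds m; have [lo' hi'] := qfact_bounds m.*2.
have t2 := triangle_mul2 m.*2; split.
  have e : (7 * m * m + m.*2 = 3 * m * m + triangle m.*2 + triangle m.*2)%N by lia.
  rewrite -(ler_pM2r (PX_gt0 m.*2)) -exprD e !exprD.
  have -> : upper_prod m ^+ 2 * P ^+ triangle m.*2 * qfact m.*2 * P ^+ m * P ^+ m.*2
    = upper_prod m ^+ 2 * P ^+ m * P ^+ triangle m.*2 * (qfact m.*2 * P ^+ m.*2) by ring.
  apply: ler_pM => //; first by rewrite mulr_ge0.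
  by rewrite ler_wpM2r.
have -> : (7 * m * m + 3 * m = 3 * m * m + m + triangle m.*2 + triangle m.*2)%N by lia.
rewrite !exprD -[P ^+ (_ * _ * _) * P ^+ m]exprD; apply: ler_pM => //.
- by rewrite mulr_ge0// ltW// exprn_gt0// upper_prod_gt0.
- by rewrite ltW// qfact_gt0.
- by rewrite ler_wpM2r.
Qed.

Lemma qbinomial_ge0 n j : 0 <= qbinomial n j.
Proof. by rewrite /qbinomial divr_ge0 ?mulr_ge0// ltW// qfact_gt0. Qed.

(** The main exponent is [triangle n - triangle j - triangle (n - j) = j (n - j)]. The lower bounds
    for the two factorials in the denominator lose [P^j] and [P^(n-j)], hence the extra [n]. *)
Lemma qbinomial_le n j : (j <= n)%N -> qbinomial n j <= P ^+ (j * (n - j) + n).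
Proof.
move=> jn; rewrite /qbinomial ler_pdivrMr ?mulr_gt0 ?qfact_gt0//.
have [_ hn] := qfact_bounds n; apply: le_trans hn _.
have [hj _] := qfact_bounds j; have [hk _] := qfact_bounds (n - j).
rewrite exprD.
have -> : P ^+ triangle n = P ^+ (j * (n - j)) * (P ^+ triangle j * P ^+ triangle (n - j)).
  rewrite -!exprD; congr (_ ^+ _).
  have := triangle_mul2 n; have := triangle_mul2 j; have := triangle_mul2 (n - j); nia.
rewrite -mulrA ler_pM2l//.
have -> : P ^+ n = P ^+ j * P ^+ (n - j) by rewrite -exprD subnKC.
have -> : P ^+ j * P ^+ (n - j) * (qfact j * qfact (n - j))
  = (qfact j * P ^+ j) * (qfact (n - j) * P ^+ (n - j)) by ring.
exact: ler_pM.
Qed.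

Lemma double_coef_le m j : (j <= m.*2)%N ->
  `|double_coef m.*2 j| <= P ^+ (6 * m * m + 9 * m).
Proof.
set n := m.*2 => jn; rewrite /double_coef /numer_coef /recip_coef.
have -> : `|(-1) ^+ (n + j) * P ^+ triangle (n - j) * qbinomial (n + j) n * qbinomial n j *
    ((-1) ^+ j * P ^+ triangle j * qbinomial n j)|
  = P ^+ (triangle (n - j) + triangle j) * (qbinomial (n + j) n * (qbinomial n j * qbinomial n j)).
  set X := P ^+ (_ + _) * _.
  have X0 : 0 <= X.
    by apply: mulr_ge0 => //; apply: mulr_ge0; [|apply: mulr_ge0]; exact: qbinomial_ge0.
  transitivity `|(-1) ^+ (n + j + j) * X|; last by rewrite normrM normr_sign mul1r ger0_norm.
  by congr `|_|; rewrite /X !exprD; ring.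
have h1 := qbinomial_le (leq_addr j n); have h2 := qbinomial_le jn.
apply: (@le_trans _ _ (P ^+ (triangle (n - j) + triangle j) *
   (P ^+ (n * (n + j - n) + (n + j)) * (P ^+ (j * (n - j) + n) * P ^+ (j * (n - j) + n))))).
  rewrite ler_pM2l//; apply: ler_pM => //; first exact: qbinomial_ge0.
    by apply: mulr_ge0; exact: qbinomial_ge0.
  by apply: ler_pM => //; exact: qbinomial_ge0.
(* The quadratic part of the exponent is [n^2 / 2 + 2 n j - j^2]. On [j <= n] it is largest at
   [j = n], with value [3 n^2 / 2 = 6 m^2]. *)
rewrite -!exprD PX_le// addKn.
have := triangle_mul2 (n - j); have := triangle_mul2 j.
have [k nk] : exists k, n = (j + k)%N by exists (n - j)%N; rewrite subnKC.
rewrite nk addKn; move: nk; rewrite /n => nk; nia.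
Qed.

Lemma lead_le m : `|lead m| <= P ^+ (9 * m * m + 12 * m).
Proof.
have [_ hi] := upper_prod_bounds m.
rewrite normrM (ger0_norm (ltW (exprn_gt0 _ (upper_prod_gt0 _))))//.
have -> : (9 * m * m + 12 * m = (3 * m * m + m) + (m.*2 + (6 * m * m + 9 * m)))%N by lia.
rewrite exprD; apply: ler_pM => //; first by rewrite ltW// exprn_gt0// upper_prod_gt0.
apply: le_trans (ler_norm_sum _ _ _) _.
apply: (@le_trans _ _ (\sum_(j < m.*2.+1) P ^+ (6 * m * m + 9 * m))).
  by apply: ler_sum => j _; apply: double_coef_le; rewrite -ltnS.
rewrite sumr_const card_ord (exprD _ m.*2) -[leLHS]mulr_natl ler_pM2r//.
(* The number of terms is absorbed by [n + 1 <= P^n]. *)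
elim: (m.*2) => [|n IHn]; first by rewrite expr0.
rewrite exprS -natr1; have := ler_wpM2r (PX_ge0 n) P_ge2.
by have := PX_ge1 n; move: IHn; lra.
Qed.

(** * Size of the sum over the powers of [P] *)

Lemma integrand_zero n k : (k < n)%N -> integrand n (P ^+ k.+1) = 0.
Proof. by move=> kn; rewrite /integrand (bigD1 (Ordinal kn))//= subrr mul0r mulr0 mul0r. Qed.

Let den_bounds n k :
  P ^+ (n * n.+1 + 2 * n.+1 * k) <= (\prod_(i < n.+1) (P ^+ i * P ^+ k.+1 - 1)) ^+ 2
     <= P ^+ (n * n.+1 + 2 * n.+1 * k.+1).
Proof.
have -> : \prod_(i < n.+1) (P ^+ i * P ^+ k.+1 - 1) = \prod_(i < n.+1) (P ^+ (k + i).+1 - 1).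
  by apply: eq_bigr => i _; rewrite -exprD addnS addnC.
have /andP[lo hi] := prod_pow_sub1_bounds n.+1 (addn k).
have p0 : 0 <= \prod_(i < n.+1) (P ^+ (k + i).+1 - 1) by apply: le_trans lo.
apply/andP; split.
  have -> : (n * n.+1 + 2 * n.+1 * k = (\sum_(i < n.+1) (k + i)) * 2)%N.
    have := sum_ord_mul2 n.+1 k; lia.
  by rewrite exprM lerXn2r// nnegrE ?PX_ge0.
have -> : (n * n.+1 + 2 * n.+1 * k.+1 = (\sum_(i < n.+1) (k + i).+1) * 2)%N.
  have := sum_ord_mul2 n.+1 k.+1; under eq_bigr => i _ do rewrite addSn.
  lia.
by rewrite exprM lerXn2r// nnegrE ?PX_ge0.
Qed.

Let den_gt0 n k : 0 < (\prod_(i < n.+1) (P ^+ i * P ^+ k.+1 - 1)) ^+ 2.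
Proof. by have /andP[+ _] := den_bounds n k; apply: lt_le_trans. Qed.

Lemma integrand_ge0 n k : 0 <= integrand n (P ^+ k.+1).
Proof.
have [kn|nk] := ltnP k n; first by rewrite integrand_zero.
rewrite divr_ge0 ?(ltW (den_gt0 _ _))// mulr_ge0//; apply: prodr_ge0 => i _.
by rewrite subr_ge0 PX_le// ltnS (leq_trans _ nk)// ltnW.
Qed.

(** Comparing degrees gives the bound [P * P^(-s (n+1))]; it is weakened to ratio 1/2 so that the
    sum over [s] is at most [2 P <= P^2]. *)
Lemma integrand_le n s :
  integrand n (P ^+ (n + s).+1) * P ^+ (2 * n * n + n) <= P * 2^-1 ^+ s.
Proof.
rewrite /integrand mulrAC ler_pdivrMr//.
have /andP[lo _] := den_bounds n (n + s).
apply: (@le_trans _ _ (P ^+ ((n + s).+1 * n.+1) * P ^+ (2 * n * n + n))).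
  rewrite ler_wpM2r// exprM (exprS (P ^+ (n + s).+1) n) ler_wpM2l//.
  rewrite -[X in _ <= _ ^+ X](card_ord n) -prodr_const; apply: ler_prod => i _.
  rewrite subr_ge0 PX_le ?lerBlDr ?lerDl ?PX_ge0//=.
  by rewrite ltnS (leq_trans (ltnW (ltn_ord i))) ?leq_addr.
have h2 : P ^+ (n * n.+1 + 2 * n.+1 * (n + s)) * P * 2^-1 ^+ s
   <= P * 2^-1 ^+ s * (\prod_(i < n.+1) (P ^+ i * P ^+ (n + s).+1 - 1)) ^+ 2.
  by rewrite -mulrA mulrC ler_wpM2l// mulr_ge0 ?exprn_ge0 ?invr_ge0// ltW.
apply: le_trans h2.
rewrite exprVn ler_pdivlMr ?exprn_gt0//.
apply: (@le_trans _ _ (P ^+ ((n + s).+1 * n.+1) * P ^+ (2 * n * n + n) * P ^+ s)).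
  by rewrite ler_wpM2l ?mulr_ge0// lerXn2r// nnegrE ltW.
rewrite -exprSr -!exprD PX_le//; lia.
Qed.

Lemma half_sum_le K : \sum_(s < K) 2^-1 ^+ s <= 2 - 2 * 2^-1 ^+ K :> F.
Proof.
elim: K => [|K IHK]; first by rewrite big_ord0 expr0; lra.
by rewrite big_ord_recr /= exprS; move: IHK; lra.
Qed.

Lemma sum_integrand_le m K :
  weight m * (\sum_(k < K) integrand m.*2 (P ^+ k.+1)) * P ^+ (m * m) <= P ^+ (m + 2).
Proof.
move: (weight m) (weight_gt0 m) (weight_bounds m) => w w0 [_ hw]; set n := m.*2.
have S0 : 0 <= \sum_(k < K) integrand n (P ^+ k.+1).
  by apply: sumr_ge0 => k _; exact: integrand_ge0.
have hS : (\sum_(k < K) integrand n (P ^+ k.+1)) * P ^+ (2 * n * n + n) <= P ^+ 2.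
  (* Lengthening the sum to [n + K] terms avoids comparing [K] with [n]: the first [n] terms vanish
     and exactly [K] remain. *)
  apply: (@le_trans _ _ ((\sum_(k < n + K) integrand n (P ^+ k.+1)) * P ^+ (2 * n * n + n))).
    rewrite ler_wpM2r//.
    rewrite -(big_mkord xpredT (fun k => integrand n (P ^+ k.+1))).
    rewrite -(big_mkord xpredT (fun k => integrand n (P ^+ k.+1))).
    rewrite (@big_cat_nat _ _ _ K 0 (n + K)) ?leq_addl//= lerDl.
    by apply: sumr_ge0 => k _; exact: integrand_ge0.
  rewrite big_split_ord /= big1 ?add0r => [|i _]; last by rewrite integrand_zero.
  rewrite mulr_suml; apply: (@le_trans _ _ (\sum_(s < K) P * 2^-1 ^+ s)).
    by apply: ler_sum => s _; exact: integrand_le.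
  rewrite -mulr_sumr expr2 (ler_wpM2l (ltW P_gt0))//.
  have := half_sum_le K; have : 0 <= 2^-1 ^+ K :> F by rewrite exprn_ge0 ?invr_ge0.
  by move: P_ge2; lra.
rewrite -(ler_pM2r (PX_gt0 (7 * m * m + m.*2))).
apply: (@le_trans _ _ (w * ((\sum_(k < K) integrand n (P ^+ k.+1)) * P ^+ (2 * n * n + n)))).
  rewrite -!mulrA ler_pM2l// (ler_wpM2l S0)//.
  by rewrite -exprD PX_le// /n; lia.
apply: (@le_trans _ _ (P ^+ (7 * m * m + 3 * m) * P ^+ 2)).
  by apply: ler_pM => //; [exact: ltW|exact: mulr_ge0].
by rewrite -!exprD PX_le//; lia.
Qed.

Lemma sum_integrand_ge m K : (m.*2 < K)%N ->
  1 <= weight m * (\sum_(k < K) integrand m.*2 (P ^+ k.+1)) * P ^+ (m * m + 9 * m + 1).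
Proof.
move=> mK; move: (weight m) (weight_gt0 m) (weight_bounds m) => w w0 [hw _].
set n := m.*2 in mK *.
(* All terms are nonnegative, so the first nonzero one, at [P^(n+1)], suffices; [m.*2 < K] ensures
   that it occurs. *)
apply: (@le_trans _ _ (w * integrand n (P ^+ n.+1) * P ^+ (m * m + 9 * m + 1))); last first.
  rewrite ler_wpM2r// ler_pM2l// (bigD1 (Ordinal mK))//= lerDl.
  by apply: sumr_ge0 => k _; exact: integrand_ge0.
have hR : 1 <= integrand n (P ^+ n.+1) * P ^+ (2 * n * n + 4 * n + 1).
  rewrite /integrand mulrAC ler_pdivlMr// mul1r.
  have /andP[_ hi] := den_bounds n n; apply: le_trans hi _.
  apply: (@le_trans _ _ (P ^+ (n.+1 + n * n) * P ^+ (2 * n * n + 4 * n + 1))).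
    by rewrite -exprD PX_le//; lia.
  rewrite ler_wpM2r// exprD ler_wpM2l// exprM.
  rewrite -[X in _ ^+ X <= _](card_ord n) -prodr_const; apply: ler_prod => i _.
  rewrite PX_ge0 /=; apply: le_trans (_ : P ^+ n.+1 - P ^+ n <= _).
    by rewrite lerBrDl exprS; have := ler_wpM2r (PX_ge0 n) P_ge2; lra.
  by rewrite lerB// PX_le.
rewrite -(ler_pM2r (PX_gt0 (7 * m * m))) mul1r.
have e : P ^+ (m * m + 9 * m + 1) * P ^+ (7 * m * m) = P ^+ m * P ^+ (2 * n * n + 4 * n + 1).
  by rewrite -!exprD; congr (_ ^+ _); rewrite /n; lia.
rewrite -[leRHS]mulrA e -[leLHS]mulr1.
have -> : w * integrand n (P ^+ n.+1) * (P ^+ m * P ^+ (2 * n * n + 4 * n + 1))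
  = (w * P ^+ m) * (integrand n (P ^+ n.+1) * P ^+ (2 * n * n + 4 * n + 1)) by ring.
exact: ler_pM.
Qed.
End Construction.

(** * The Lambert series *)

Section Lambert.
Variable F : realFieldType.

Lemma geometric_sum (y : F) N : y != 1 ->
  \sum_(m < N) y ^+ m.+1 = y / (1 - y) - y ^+ N.+1 / (1 - y).
Proof.
move=> y1; have h : 1 - y != 0 by rewrite subr_eq0 eq_sym.
elim: N => [|N IHN]; first by rewrite big_ord0 expr1 subrr.
by rewrite big_ord_recr /= IHN !exprS; field.
Qed.

Lemma arithmetico_geometric_sum (y : F) N : y != 1 ->
  \sum_(n < N) n.+1%:R * y ^+ n.+1 =
  y / (1 - y) ^+ 2 - (N.+1%:R * y ^+ N.+1 / (1 - y) + y ^+ N.+2 / (1 - y) ^+ 2).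
Proof.
move=> y1; have h : 1 - y != 0 by rewrite subr_eq0 eq_sym.
elim: N => [|N IHN]; first by rewrite big_ord0 expr1; field.
by rewrite big_ord_recr /= IHN -[N.+2%:R]natr1 !exprS; field.
Qed.

(** From [N = 3] on, the left side grows by at most [(5/4)^3 < 2] per step. This makes the tails
    below, of order [N^2 q^N], at most a constant over [N]. *)
Lemma cube_le_pow2 N : ((N.+1) ^ 3 <= 16 * 2 ^ N)%N.
Proof.
elim: N => [|[|[|[|N]]] IHN] //; rewrite (expnS 2).
by move: IHN; rewrite !expnS !expn0; move: (2 ^ N)%N => t; nia.
Qed.

(* Both sums are compared with the square partial sum of [n q ^ (n m)]. *)
Lemma lambert_partial_sums (q : F) N : 0 < q -> q <= 2^-1 ->
  `|\sum_(n < N) n.+1%:R * q ^+ n.+1 / (1 - q ^+ n.+1)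
    - \sum_(m < N) q ^+ m.+1 / (1 - q ^+ m.+1) ^+ 2| <= 48 / N.+1%:R.
Proof.
move=> q0 q2.
have q1 : q <= 1 by lra.
have y0 n : 0 < q ^+ n by exact: exprn_gt0.
have yge0 n : 0 <= q ^+ n by exact: ltW.
have zge0 n k : 0 <= (q ^+ n) ^+ k by exact: exprn_ge0.
have y2 n : q ^+ n.+1 <= 2^-1.
  by rewrite exprS -[2^-1]mulr1 ler_pM ?exprn_ge0 ?exprn_ile1// ltW.
have y1 n : q ^+ n.+1 != 1 by have := y2 n; apply: contraTneq => ->; lra.
have c1 n : (1 - q ^+ n.+1)^-1 <= 2.
  by rewrite -[2]invrK lef_pV2 ?posrE; have := y2 n; lra.
have c0 n : 0 <= (1 - q ^+ n.+1)^-1 by rewrite invr_ge0; have := y2 n; lra.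
have yN n : (q ^+ n.+1) ^+ N.+1 <= q ^+ N.+1.
  by rewrite -exprM; apply: ler_wiXn2l; rewrite ?(ltW q0) ?leq_pmull.
pose G := \sum_(n < N) \sum_(m < N) n.+1%:R * q ^+ (n.+1 * m.+1).
have hX : \sum_(n < N) n.+1%:R * q ^+ n.+1 / (1 - q ^+ n.+1)
   = G + \sum_(n < N) n.+1%:R * (q ^+ n.+1) ^+ N.+1 / (1 - q ^+ n.+1).
  rewrite -big_split /=; apply: eq_bigr => n _.
  under eq_bigr => m _ do rewrite exprM.
  by rewrite -mulr_sumr geometric_sum//; ring.
have hY : \sum_(m < N) q ^+ m.+1 / (1 - q ^+ m.+1) ^+ 2
   = G + \sum_(m < N) (N.+1%:R * (q ^+ m.+1) ^+ N.+1 / (1 - q ^+ m.+1)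
                       + (q ^+ m.+1) ^+ N.+2 / (1 - q ^+ m.+1) ^+ 2).
  rewrite /G exchange_big -big_split /=; apply: eq_bigr => m _.
  under eq_bigr => n _ do rewrite mulnC exprM.
  by rewrite arithmetico_geometric_sum// subrK.
(* The two tails lie in [[0, 2 e]] and [[0, 6 e]], because [q <= 1/2] bounds each [1 / (1 - q^n)] by
   2. As [e <= 8 / (N + 1)], their difference is at most [48 / (N + 1)]. *)
pose e := N.+1%:R ^+ 2 * q ^+ N.+1.
have N0 : 0 <= N%:R :> F by exact: ler0n.
have bX : 0 <= \sum_(n < N) n.+1%:R * (q ^+ n.+1) ^+ N.+1 / (1 - q ^+ n.+1) <= 2 * e.
  apply/andP; split.
    by apply: sumr_ge0 => n _; rewrite !mulr_ge0.
  apply: (@le_trans _ _ (\sum_(n < N) N.+1%:R * q ^+ N.+1 * 2)).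
    apply: ler_sum => n _; apply: ler_pM => //; first by rewrite mulr_ge0.
    by apply: ler_pM => //; rewrite ler_nat ltnS ltnW.
  rewrite sumr_const card_ord -mulr_natl /e -natr1.
  rewrite -subr_ge0; set d := (X in 0 <= X).
  have -> : d = 2 * (N%:R + 1) * q ^+ N.+1 by rewrite /d; ring.
  by rewrite !mulr_ge0// addr_ge0.
have bY : 0 <= \sum_(m < N) (N.+1%:R * (q ^+ m.+1) ^+ N.+1 / (1 - q ^+ m.+1)
                       + (q ^+ m.+1) ^+ N.+2 / (1 - q ^+ m.+1) ^+ 2) <= 6 * e.
  apply/andP; split.
    apply: sumr_ge0 => m _; rewrite -exprVn addr_ge0//; first by rewrite !mulr_ge0.
    by rewrite mulr_ge0// exprn_ge0.
  apply: (@le_trans _ _ (\sum_(n < N) (N.+1%:R * q ^+ N.+1 * 2 + q ^+ N.+1 * 2 ^+ 2))).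
    apply: ler_sum => m _; apply: lerD.
      apply: ler_pM => //; first by rewrite mulr_ge0.
      by rewrite ler_wpM2l.
    rewrite -exprVn; apply: ler_pM => //; rewrite ?exprn_ge0//; last first.
      by rewrite lerXn2r// nnegrE.
    rewrite exprS; apply: le_trans (yN m); rewrite ler_piMl//.
    by have := y2 m; lra.
  rewrite sumr_const card_ord -mulr_natl /e -natr1.
  rewrite -subr_ge0; set d := (X in 0 <= X).
  have -> : d = (4 * N%:R ^+ 2 + 6 * N%:R + 6) * q ^+ N.+1 by rewrite /d; ring.
  apply: mulr_ge0 => //; have := sqr_ge0 (N%:R : F); lra.
have he : e <= 8 / N.+1%:R.
  rewrite ler_pdivlMr ?ltr0n//.
  have hq : q ^+ N.+1 <= 2^-1 ^+ N.+1 by rewrite lerXn2r// nnegrE ?invr_ge0// (ltW q0).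
  have : (N.+1%:R ^+ 3 : F) <= 16 * 2 ^+ N by rewrite -!natrX -natrM ler_nat cube_le_pow2.
  have h2 : 2^-1 ^+ N.+1 * 2 ^+ N.+1 = 1 :> F by rewrite -exprMn mulVf ?expr1n ?pnatr_eq0.
  have -> : e * N.+1%:R = N.+1%:R ^+ 3 * q ^+ N.+1 by rewrite /e; ring.
  move=> h3; apply: (@le_trans _ _ (16 * 2 ^+ N * 2^-1 ^+ N.+1)).
    by apply: ler_pM => //; rewrite exprn_ge0.
  by move: h2; rewrite [2 ^+ N.+1]exprS; lra.
rewrite hX hY opprD addrACA subrr add0r.
have -> : 48 / N.+1%:R = 6 * (8 / N.+1%:R) :> F by ring.
move: bX bY he; move: (\sum_(n < N) _) (\sum_(m < N) _) (8 / _) => u v w /andP[u0 ue] /andP[v0 ve] he.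
by rewrite ler_norml; apply/andP; split; lra.
Qed.
End Lambert.

(** * Passage to the limit *)

Section Limits.

Lemma is_lim_seq_bigsum n (u : 'I_n -> nat -> R) (l : 'I_n -> R) :
  (forall j, is_lim_seq (u j) (l j)) ->
  is_lim_seq (fun K => \sum_j u j K) (\sum_j l j).
Proof.
elim: n u l => [|n IHn] u l h.
  rewrite big_ord0; apply: is_lim_seq_ext (is_lim_seq_const 0) => K.
  by rewrite big_ord0.
rewrite big_ord_recr /=.
apply: is_lim_seq_ext; last by apply: is_lim_seq_plus'; [apply: IHn => j|]; exact: h.
by move=> K; rewrite big_ord_recr.
Qed.

Lemma bigsum_sum_n (f : nat -> R) K : \sum_(k < K.+1) f k = sum_n f K.
Proof.
elim: K => [|K IHK]; first by rewrite big_ord_recr big_ord0 /= add0r sum_O.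
by rewrite big_ord_recr /= IHK sum_Sn.
Qed.

Lemma is_lim_seq_Series (f : nat -> R) : ex_series f ->
  is_lim_seq (fun K => \sum_(k < K) f k) (Series f).
Proof.
move=> /Series_correct h; apply/is_lim_seq_incr_1.
by apply: (is_lim_seq_ext (sum_n f) _ (Series f) _ h) => K; rewrite bigsum_sum_n.
Qed.

Lemma is_series_bigsum (f : nat -> R) (l : R) :
  is_lim_seq (fun K => \sum_(k < K) f k) l -> is_series f l.
Proof.
move=> /is_lim_seq_incr_1 h.
by apply: (is_lim_seq_ext _ (sum_n f) l _ h) => K; rewrite bigsum_sum_n.
Qed.

Lemma is_lim_seq_inv_succ (c : R) : is_lim_seq (fun N => c / N.+1%:R) (Rbar.Finite 0).
Proof.
apply: (is_lim_seq_ext (fun N => Rmult c (Rinv (INR N.+1)))).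
  by move=> N; rewrite INRE.
have -> : Rbar.Finite 0 = Rbar_mult c (Rbar.Finite 0) by rewrite /= RmultE mulr0.
apply: is_lim_seq_scal_l.
apply: (is_lim_seq_inv (fun N => INR N.+1) p_infty) => //.
by apply/(is_lim_seq_incr_1 INR); exact: is_lim_seq_INR.
Qed.

Variable P : R.
Hypothesis P_ge2 : 2 <= P.

Lemma zterm_le k : 0 <= zterm P k.+1 <= 2^-1 ^+ k.
Proof.
have h : P ^+ k <= P ^+ k.+1 - 1 by exact: powS_sub1_ge.
have P0 : 0 < P ^+ k by rewrite exprn_gt0//; move: P_ge2; lra.
have h0 : 0 < P ^+ k.+1 - 1 by exact: lt_le_trans h.
rewrite /zterm invr_ge0 (ltW h0) /= exprVn lef_pV2 ?posrE ?exprn_gt0//.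
apply: le_trans h; rewrite lerXn2r// nnegrE; move: P_ge2; lra.
Qed.

Lemma ex_series_zterm : ex_series (fun k => zterm P k.+1).
Proof.
apply: (ex_series_le _ (fun k => pow (2^-1)%R k)) => [k|].
  apply/RleP; have /andP[h0 h1] := zterm_le k.
  by rewrite /norm /= /abs /= RabsE ger0_norm// RpowE.
apply: ex_series_geom; rewrite RabsE; apply/RltP; rewrite ger0_norm ?invr_ge0//.
by rewrite invf_lt1 ?ltr1n.
Qed.

Lemma ex_series_zterm2 : ex_series (fun k => zterm P k.+1 + zterm P k.+1 ^+ 2).
Proof.
apply: (ex_series_le _ (fun k => Rmult 2%:R (zterm P k.+1))) => [k|].
  apply/RleP; have /andP[h0 h1] := zterm_le k.
  have h2 : zterm P k.+1 <= 1.
    by apply: le_trans h1 _; rewrite exprn_ile1 ?invr_ge0// invf_le1 ?ler1n.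
  rewrite /norm /= /abs /= RabsE ger0_norm ?addr_ge0 ?exprn_ge0//.
  by rewrite RmultE; move: h0 h2; move: (zterm P _) => z; nra.
exact/ex_series_scal_l/ex_series_zterm.
Qed.

Lemma is_lim_seq_zsum1 : is_lim_seq (zsum1 P) (Series (fun k => zterm P k.+1)).
Proof. exact/is_lim_seq_Series/ex_series_zterm. Qed.

(** Partial sums of the two Lambert forms differ by a null sequence, so convergence of the
    right-hand series also gives that of the series defining [qzeta2]. *)
Lemma qzeta2E : qzeta2 (1 / P) = Series (fun k => zterm P k.+1 + zterm P k.+1 ^+ 2).
Proof.
have -> : Rdiv (IZR 1) P = P^-1 by rewrite RdivE R1E div1r.
rewrite /qzeta2; apply: is_series_unique; set q : R := P^-1.
have lim2 := is_lim_seq_Series ex_series_zterm2.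
set s := Series _ in lim2 *.
apply: is_series_bigsum.
have P0 : P != 0 by move: P_ge2; apply: contraTneq => ->; lra.
have q0 : 0 < q by rewrite invr_gt0; move: P_ge2; lra.
have q2 : q <= 2^-1 by rewrite lef_pV2// posrE; move: P_ge2; lra.
have diff : is_lim_seq (fun N =>
   \sum_(k < N) INR k.+1 * pow q k.+1 / (1 - pow q k.+1)
   - \sum_(k < N) (zterm P k.+1 + zterm P k.+1 ^+ 2)) (Rbar.Finite 0).
  apply/is_lim_seq_abs_0.
  apply: is_lim_seq_le_le (is_lim_seq_const 0) (is_lim_seq_inv_succ 48%R) => N.
  split; first exact: Rabs_pos.
  apply/RleP; rewrite RabsE.
  have := lambert_partial_sums N q0 q2.
  under eq_bigr => k _ do rewrite -INRE -RpowE.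
  under [X in _ - X]eq_bigr => k _.
    have -> : q ^+ k.+1 / (1 - q ^+ k.+1) ^+ 2 = zterm P k.+1 + zterm P k.+1 ^+ 2.
      have h : 0 < P ^+ k.+1 - 1 by exact: powS_sub1_gt0.
      have h' : P ^+ k.+1 != 0 by rewrite expf_neq0.
      by rewrite /zterm /q exprVn; field; rewrite h' gt_eqF.
    over.
  exact.
have e : Rplus 0%R s = s by exact: add0r.
have := is_lim_seq_plus' _ _ _ _ diff lim2; rewrite e.
by apply: is_lim_seq_ext => N; rewrite RplusE subrK.
Qed.

Lemma is_lim_seq_zsum2 : is_lim_seq (zsum2 P) (qzeta2 (1 / P)).
Proof. by rewrite qzeta2E; exact/is_lim_seq_Series/ex_series_zterm2. Qed.

Lemma is_lim_seq_shift (u : nat -> R) (l : R) j :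
  is_lim_seq u l -> is_lim_seq (fun K => u (j + K)%N) l.
Proof.
move=> /(is_lim_seq_incr_n u j) h.
by apply: is_lim_seq_ext h => K; rewrite addnC.
Qed.

Hypothesis P_int : P \is a Num.int.

(** In the limit every [j] contributes the same value of zeta_q(1), with total coefficient zero by
    [sum_simple_coef]. *)
Lemma is_lim_seq_weighted_sum m :
  is_lim_seq (fun K => weight P m * \sum_(k < K) integrand P m.*2 (P ^+ k.+1))
    (lead P m * qzeta2 (1 / P) - offset P m).
Proof.
have -> : lead P m * qzeta2 (1 / P) - offset P m
  = \sum_(j < m.*2.+1) (upper_prod P m ^+ 2 * double_coef P m.*2 j * qzeta2 (1 / P)
      + upper_prod P m * simple_coef P m j * Series (fun k => zterm P k.+1)) - offset P m.
  rewrite big_split /= -!mulr_suml -!mulr_sumr sum_simple_coef//.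
  by rewrite mulr0 mul0r addr0.
apply: (is_lim_seq_ext (fun K => \sum_(j < m.*2.+1)
      (upper_prod P m ^+ 2 * double_coef P m.*2 j * zsum2 P (j + K)
        + upper_prod P m * simple_coef P m j * zsum1 P (j + K)) - offset P m)).
  by move=> K; rewrite sum_integrand.
apply: is_lim_seq_minus'; last exact: is_lim_seq_const.
apply: is_lim_seq_bigsum => j; apply: is_lim_seq_plus'.
  by apply: (is_lim_seq_scal_l _ _ (Rbar.Finite _)); exact/is_lim_seq_shift/is_lim_seq_zsum2.
by apply: (is_lim_seq_scal_l _ _ (Rbar.Finite _)); exact/is_lim_seq_shift/is_lim_seq_zsum1.
Qed.

Lemma linear_form_bounds m : let eps := lead P m * qzeta2 (1 / P) - offset P m in
  1 <= eps * P ^+ (m * m + 9 * m + 1) /\ eps * P ^+ (m * m) <= P ^+ (m + 2).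
Proof.
move=> eps; have lim := @is_lim_seq_weighted_sum m; rewrite -/eps in lim.
have P0 n : 0 < P ^+ n by rewrite exprn_gt0//; move: P_ge2; lra.
split.
  rewrite -ler_pdivrMr//; apply/RleP.
  apply: (@is_lim_seq_le_loc (fun=> 1 / P ^+ (m * m + 9 * m + 1)) _
    (Rbar.Finite (1 / P ^+ (m * m + 9 * m + 1))) (Rbar.Finite eps) _ (is_lim_seq_const _) lim).
  exists m.*2.+1 => K /ssrnat.leP hK; apply/RleP; rewrite ler_pdivrMr//.
  exact: sum_integrand_ge.
rewrite -ler_pdivlMr//; apply/RleP.
apply: (@is_lim_seq_le _ (fun=> P ^+ (m + 2) / P ^+ (m * m))
    (Rbar.Finite eps) (Rbar.Finite (P ^+ (m + 2) / P ^+ (m * m))) _ lim (is_lim_seq_const _)).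
by move=> K; apply/RleP; rewrite ler_pdivlMr//; exact: sum_integrand_le.
Qed.

End Limits.

(** * Linear forms with coefficients in [Z] *)

Lemma IZR_int (z : Z) : IZR z \is a Num.int.
Proof.
by case: z => [|k|k]; rewrite ?R0E ?rpred0// -?[Zneg k]/(Z.opp (Zpos k)) ?opp_IZR ?RoppE ?rpredN
  IZRposE INRE rpred_nat.
Qed.

Lemma int_IZR (x : R) : x \is a Num.int -> exists z : Z, x = IZR z.
Proof.
move=> /intrP[[n|n] ->].
  by exists (Z.of_nat n); rewrite -INR_IZR_INZ INRE.
by exists (Z.opp (Z.of_nat n.+1)); rewrite opp_IZR -INR_IZR_INZ INRE.
Qed.

Lemma qzeta2_linear_forms (p : Z) (m : nat) : Z.le 2 p -> exists A C : Z,
  Rle (Rabs (IZR A)) (pow (IZR p) (9 * m * m + 12 * m)) /\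
  Rle 1 (Rmult (Rminus (Rmult (IZR A) (qzeta2 (1 / IZR p))) (IZR C))
          (pow (IZR p) (m * m + 9 * m + 1))) /\
  Rle (Rmult (Rminus (Rmult (IZR A) (qzeta2 (1 / IZR p))) (IZR C)) (pow (IZR p) (m * m)))
      (pow (IZR p) (m + 2)).
Proof.
move=> /IZR_le /RleP p2.
have {}p2 : (2 : R) <= IZR p.
  by apply: le_trans p2; rewrite IZRposE INRE.
have pint := IZR_int p.
have [A hA] := int_IZR (lead_int pint p2 m).
have [C hC] := int_IZR (offset_int pint p2 m).
have [h1 h2] := linear_form_bounds p2 pint m; rewrite hA hC in h1 h2.
exists A, C; rewrite !RpowE; split; last by split; apply/RleP.
by apply/RleP; rewrite RabsE -hA; exact: lead_le.
Qed.

End LinearForms.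

(** * Numerical comparison and conclusion *)

Lemma ten_lt_exponent_bound : 10 < 3 * PI ^ 2 / (PI ^ 2 - 8).
Proof.
  (* The claim amounts to [7 PI^2 < 80]. Five terms of the Leibniz series give [PI < 3.34], which is
     enough. *)
  assert (hup : PI < 169 / 50).
  { pose proof (PI_ineq 2) as [_ h].
    unfold tg_alt, PI_tg in h; simpl in h. lra. }
  assert (hlo : 3 < PI) by (pose proof PI2_3_2; lra).
  apply Rmult_lt_reg_r with (PI ^ 2 - 8); [nra|].
  unfold Rdiv; rewrite Rmult_assoc, Rinv_l; nra.
Qed.

Theorem mainTheorem5 (p : Z) (hp : (2 <= p)%Z) :
  Rbar_le (irrationality_measure (qzeta2 (1 / IZR p)))
          (Finite (3 * PI ^ 2 / (PI ^ 2 - 8))).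
Proof.
  destruct (Glb_Rbar_correct (finitely_many_solutions (qzeta2 (1 / IZR p)))) as [hlb _].
  (* The infimum is at most any admissible exponent, so it suffices that the stated bound is itself
     admissible. *)
  apply hlb, finitely_many_of_linear_forms with (IZR p).
  - now apply IZR_le.
  - exact ten_lt_exponent_bound.
  - intros m; exact (@LinearForms.qzeta2_linear_forms p m hp).
Qed.
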